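(* Assume monotone protection and follow-through uncertainty, consider expression mechanisms in the environment described in the context, and suppose $C^-(S)\subsetneq C^+(S)$. (i) No public-only mechanism satisfying regret-free safety reaches, in any realization, a public coalition outside $\{C: C_0\subseteq C\subseteq C^-(S)\}$; in particular none implements $C^+(S)$. (ii) Any regret-free mechanism that in some realization reaches a public coalition $D\not\subseteq C^-(S)$ contains a private conditional-release stage: at the first completed action that moves the public set outside $C^-(S)$, the device executing the action has already received a still-private (completed, not yet publicly attributed) commitment from every agent that the action newly names, other than possibly the action's own author, and this set of commitments is nonempty.
   Context: Coalitions. $C_0$ (the vanguard, possibly empty) and $N$ are disjoint finite sets; $S\subseteq N$ is the set of supporters. A coalition is a set $C$ with $C_0\subseteq C\subseteq C_0\cup S$. For each $i\in C_0\cup S$ a family $\mathcal P_i$ of coalitions containing $i$ is given, with $C_0\in\mathcal P_i$ for all $i\in C_0$. Monotone protection: $C\in\mathcal P_i$, $C\subseteq C'$ imply $C'\in\mathcal P_i$. $C$ is self-protecting if $C\in\mathcal P_i$ for all $i\in C$. $T(C)=C\cup\{i\in S\setminus C: C\cup\{i\}\in\mathcal P_i\}$, $C^-(S)=T^{|S|}(C_0)$, and $C^+(S)$ is the union of all self-protecting coalitions. Environment (causal action histories). (1) Each attempted action has one author and is a separate event; once completed it is irreversible. A public action completes when the statement becomes public under its author's name; a private commitment completes when it reaches its recipient. Every subset of a date's attempted individual actions is an admissible completion outcome (exactly those complete, the others do not). Histories record completions in their realized order, including within a date, and public attribution updates at each completion, before any device action at that date. (2) Information moves only through completed actions. Each action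 has a designated recipient that can verify its completion. Each action has a deterministic set of people it names (publicly attributes), realized at completion. Receipt by a device is not itself public attribution. (3) A device (a person or automated system, possibly composite, that executes an action) chooses its action and the set it names using only the public history and the completed actions it received strictly before execution. If an unattributed completed action is absent from that received record, then there is an admissible twin history with the same public and received record in which that action never completed, and the device takes the same action at both histories. (4) Permission binds action by action: an action cannot name an agent other than its author unless that agent has completed, on the realized history, an action permitting publication. Expression mechanism: an extensive form game between an administrator (device) and the agents in $S$. At each time agents attempt exposure actions, which publish their expression under their identity when completed, or private commitments, which the administrator verifies on receipt and holds without public attribution. The administrator observes completed exposure actions and the private commitments it received; agents observe the nondecreasing public state $C_h$ (the set of publicly attributed people at history $h$), starting from $C_0$. The mechanism may change the public coalition only in response to completed exposure actions or private commitments it received. The mechanism is permission-respecting: a new expression becomes public under a recruit's identity only through her own completed exposure action or a joint publication she permitted. It is public-only if its publications condition only on completed exposure actions. Follow-through uncertainty: unless the institution has verified co-participants before exposure (received and certified their endorsements), any subset of a date's attempted public actions may be exactly the set that completes; in particular, for each attempting $i$, the realization in which only $i$'s public action completes is admissible. Regret-free safety: at every admissible realization, at each completion, the resulting public coalition $C$ satisfies $C\in\mathcal P_i$ for every $i\in C$.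
   Formalization: The twin history is required to differ only by non-completion (its completed actions all lie in the original history), and public-only is read in the same twin sense; otherwise alternative permits from one agent, relayed to the device, would refute (ii). *)

(* Defs.v *)
From mathcomp Require Import all_boot.

Set Implicit Arguments.
Unset Strict Implicit.
Unset Printing Implicit Defensive.

Section Coalitions.
Variables (I : finType) (C0 S : {set I}) (P : I -> {set {set I}}).
Implicit Types (i : I) (C : {set I}).

Definition coalition C : bool := (C0 \subset C) && (C \subset C0 :|: S).

(* [P] is only meaningful on [C0 :|: S]. *)
Definition protection_family : Prop :=
  (forall i C, i \in C0 :|: S -> C \in P i -> coalition C /\ i \in C) /\
  (forall i, i \in C0 -> C0 \in P i).

Definition monotone_protection : Prop :=
  forall i C C', i \in C0 :|: S -> C \in P i -> coalition C' -> C \subset C' ->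
    C' \in P i.

Definition self_protecting C : bool :=
  coalition C && [forall i in C, C \in P i].

Definition recruit C : {set I} :=
  C :|: [set i in S :\: C | i |: C \in P i].

Definition Cminus : {set I} := iter #|S| recruit C0.

Definition Cplus : {set I} := \bigcup_(C : {set I} | self_protecting C) C.

End Coalitions.

(* A party is a person of [I] or one of the systems of [V]; a device is the
   list of the parties it is composed of, a person acting alone being the
   singleton device. *)
Notation party I V := (sum I V).
Notation device I V := (seq (party I V)).

(* Elements of [action] are individual events, so that the same [a] can be
   recognized in different realizations.  [permits a] says that [a] is an act
   by which its author permits publication under her name. *)
Record action_space (I : finType) (V : eqType) := ActionSpace {
  action : eqType;
  author : action -> party I V;
  executor : action -> device I V;
  recipient : action -> party I V;
  public : pred action;
  names : action -> {set I};
  permits : pred action }.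

(* One date: the individual actions attempted (simultaneously), those of them
   that complete, in order of completion, and then the device actions, in
   order.  Executing a device action completes it. *)
Record stage (A : Type) := Stage {
  attempted : seq A;
  followed : seq A;
  device_acts : seq A }.

(* An admissible realization runs up to the end of some date; it need not be
   maximal, so games without a last date are covered. *)
Record mechanism (I : finType) (V : eqType) := Mechanism {
  acts :> action_space I V;
  administrator : device I V;
  admissible : seq (stage (action acts)) -> Prop }.

Arguments admissible {I V} _ _.

Section Mechanisms.
Variables (I : finType) (V : eqType) (C0 S : {set I}).
Variables (P : I -> {set {set I}}) (M : mechanism I V).

Local Notation act := (action M).
Local Notation author := (@author I V M).
Local Notation executor := (@executor I V M).
Local Notation recipient := (@recipient I V M).
Local Notation public := (@public I V M).
Local Notation names := (@names I V M).
Local Notation permits := (@permits I V M).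

Implicit Types (a b x : act) (s : stage act) (r : seq (stage act)).
Implicit Types (h : seq act) (d : device I V) (i j : I) (t : nat).

Definition exposure a : bool :=
  public a && [exists i, (author a == inl i) && (names a == [set i])].

Definition commitment a : bool :=
  ~~ public a && [exists i, author a == inl i].

Definition individual a : bool :=
  (executor a == [:: author a]) && (exposure a || commitment a).

Definition publication a : bool := public a && ~~ exposure a.

(* A history is the sequence of completed actions in realized order;
   [past r t] is the history at the beginning of date [t]. *)
Definition past r t : seq act :=
  flatten [seq followed s ++ device_acts s | s <- take t r].

Definition completions r : seq act := past r (size r).

(* [executes r t a h]: in [r], the action [a] is executed at date [t], when
   the completed actions are exactly [h].  An individual action is executed
   when it is attempted, a device action when it completes. *)
Definition executes r t a h : Prop :=
  let s := nth (Stage [::] [::] [::]) r t in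
  (a \in attempted s /\ h = past r t) \/
  (exists u v, device_acts s = u ++ a :: v /\
     h = past r t ++ followed s ++ u).

(* [completes r h a]: in [r], the action [a] completes right after [h]. *)
Definition completes r h a : Prop := prefix (rcons h a) (completions r).

Definition public_state h : {set I} := C0 :|: \bigcup_(a <- h) names a.

Definition unattributed h a : Prop :=
  exists2 i, author a = inl i & i \notin public_state h.

Definition attribution_rules : Prop :=
  forall a,
    [/\ names a \subset C0 :|: S,
        public a -> forall i, author a = inl i -> i \in names a
      & ~~ public a -> names a = set0].

Definition well_formed r : Prop :=
  [/\ uniq (flatten [seq attempted s ++ device_acts s | s <- r]),
      uniq (completions r)
    & forall t, let s := nth (Stage [::] [::] [::]) r t in
        [/\ all individual (attempted s),
            {subset followed s <= attempted s}
          & all (predC individual) (device_acts s)]].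

Definition free_completion : Prop :=
  forall r1 s r2 (B : pred act), admissible M (r1 ++ s :: r2) ->
    {subset B <= attempted s} ->
    exists s' r2', [/\ admissible M (r1 ++ s' :: r2'),
                       attempted s' = attempted s & followed s' =i B].

(* What [d] itself executed before date [t] (completed or not) or in [h]. *)
Definition own d r t h : seq act :=
  [seq x <- flatten [seq attempted s | s <- take t r] ++ h | executor x == d].

(* Devices choose the actions in [sel] using only the part of the history
   selected by [view].  First, what a device can execute depends only on that
   part, the date and its own past actions; the agents are free players, so
   this is a condition on the set of executable actions, which is a singleton
   for a device following a deterministic rule.  Second, a completed
   unattributed action outside the view is absent from some twin history with
   the same view, at which the device takes the same action.  A twin differs
   from the original by non-completion only: otherwise the missing action
   could be replaced in it by another one of the same author and with the
   same content. *)
Definition relies_only_on (sel : pred act) (view : device I V -> pred act) :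
    Prop :=
  (forall r r' t a b h h',
     admissible M r -> admissible M r' -> executes r t a h -> executes r' t b h' ->
     sel a -> sel b -> executor b = executor a ->
     individual b = individual a ->
     filter (view (executor a)) h' = filter (view (executor a)) h ->
     own (executor a) r' t h' = own (executor a) r t h ->
     exists r'', [/\ admissible M r'', take t r'' = take t r'
                   & executes r'' t a h']) /\
  (forall r t a h x,
     admissible M r -> executes r t a h -> sel a ->
     x \in h -> unattributed h x -> ~~ view (executor a) x ->
     exists r' t' h',
       [/\ admissible M r', executes r' t' a h',
           filter (view (executor a)) h' = filter (view (executor a)) h,
           {subset h' <= h} & x \notin h']).

Definition record_based : Prop :=
  relies_only_on predT (fun d x => public x || (recipient x \in d)).

Definition permitted h j : Prop :=
  exists x, [/\ x \in h, author x = inl j & permits x].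

(* For newly named agents this also says that the mechanism respects
   permissions. *)
Definition permission_binds : Prop :=
  forall r h a j, admissible M r -> completes r h a ->
    j \in names a -> j \in S -> author a <> inl j -> permitted h j.

Definition causal_environment : Prop :=
  [/\ attribution_rules, forall r, admissible M r -> well_formed r,
      free_completion, record_based & permission_binds].

Definition responsive : Prop :=
  relies_only_on
    [pred a | publication a & executor a == administrator M]
    (fun d x => exposure x || (commitment x && (recipient x \in d))).

Definition expression_mechanism : Prop := causal_environment /\ responsive.

Definition public_only : Prop :=
  relies_only_on publication (fun _ => exposure).

(* The institution holds an endorsement of every person attempting a public
   action in [s]. *)
Definition verified h s : Prop :=
  forall a, a \in attempted s -> public a ->
    exists x, [/\ x \in h, commitment x, author x = author a
                & recipient x \in administrator M].

Definition follow_through_uncertainty : Prop :=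
  forall r1 s r2 (B : pred act), admissible M (r1 ++ s :: r2) ->
    ~ verified (completions r1) s ->
    {subset B <= [seq a <- attempted s | public a]} ->
    exists s' r2', [/\ admissible M (r1 ++ s' :: r2'),
                       attempted s' = attempted s
                     & [seq a <- followed s' | public a] =i B].

Definition regret_free : Prop :=
  forall r h a, admissible M r -> completes r h a ->
    forall i, i \in public_state (rcons h a) ->
      public_state (rcons h a) \in P i.

Definition reaches_in r (D : {set I}) : Prop :=
  exists2 h, prefix h (completions r) & D = public_state h.

Definition implements (D : {set I}) : Prop :=
  exists2 r, admissible M r & reaches_in r D.

Definition newly_named h a : {set I} := names a :\: public_state h.

(* [x] is a commitment of [j], completed and received by [d] within [h]. *)
Definition received_commitment d h j x : Prop :=
  [/\ x \in h, commitment x, permits x, author x = inl j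
    & recipient x \in d].

(* [h] is the history at the completion of the crossing action [a], [h'] the
   history at its execution; a commitment is still private if its author is
   not in the public state. *)
Definition conditional_release r (K : {set I}) : Prop :=
  exists h a t h',
    [/\ completes r h a, public_state h \subset K,
        ~~ (public_state (rcons h a) \subset K),
        executes r t a h'
      & (forall j, j \in newly_named h a -> author a <> inl j ->
           exists2 x, received_commitment (executor a) h' j x
                    & unattributed h x) /\
        (exists j x, [/\ j \in newly_named h a, author a <> inl j,
                         received_commitment (executor a) h' j x
                       & unattributed h x])].

End Mechanisms.

Arguments reaches_in {I V} C0 M r D.
Arguments conditional_release {I V} C0 M r K.

(* Main.v *)
Require Import Defs.
From mathcomp Require Import all_boot.

(** [Cminus] is a fixed point of [recruit], so by monotone protection and
    regret-freeness no public state inside [Cminus] can be left by a completion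
    that newly names a single person, its author.  Hence the first completion
    leaving [Cminus] is a publication naming somebody else, who must have
    permitted it; her permission, made before she was public, is a private
    commitment.  If the executing device saw none of her permissions, twin
    histories would remove them one after the other, until the same
    publication is executed without any permission.  So the device received
    one of them, which is impossible for a device that sees only exposures. *)

Set Implicit Arguments.
Unset Strict Implicit.
Unset Printing Implicit Defensive.

(** Serves to locate a completion: the blocks will be the completions of the successive dates, and
    [t] the date of [a]. *)
Lemma prefix_rcons_flatten (T : eqType) (ss : seq (seq T)) h a :
  prefix (rcons h a) (flatten ss) ->
  exists t u v, nth [::] ss t = u ++ a :: v /\ h = flatten (take t ss) ++ u.
Proof.
elim: ss h => [|s ss IH] h /=; first by case: h.
case/prefixP=> w; rewrite cat_rcons => E.
(* Either [a] falls inside the first block, or [h] exhausts that block and the induction hypothesis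
   applies to the rest. *)
have [lt_hs | le_sh] := ltnP (size h) (size s).
  have Es : s = h ++ drop (size h) s.
    have := congr1 (take (size h)) E.
    rewrite (takel_cat _ (ltnW lt_hs)) take_size_cat // => {1}<-.
    by rewrite cat_take_drop.
  move: E; rewrite Es -catA => /eqP; rewrite eqseq_cat // eqxx => /eqP.
  case D: (drop (size h) s) => [|b v] /= => [_ | [-> _]].
    by move: lt_hs; rewrite {1}Es D cats0 ltnn.
  by exists 0, h, v.
have Eh : h = s ++ drop (size s) h.
  have := congr1 (take (size s)) E; rewrite take_size_cat // takel_cat //.
  by move=> {1}->; rewrite cat_take_drop.
have /IH[t [u [v [Et Eu]]]] : prefix (rcons (drop (size s) h) a) (flatten ss).
  apply/prefixP; exists w; rewrite cat_rcons.
  by move: E; rewrite {1}Eh -catA => /eqP; rewrite eqseq_cat // eqxx => /eqP.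
by exists t.+1, u, v; split=> //=; rewrite {1}Eh Eu catA.
Qed.

(** * The recruitment operator and its fixed point *)

Section Recruitment.
Variables (I : finType) (C0 S : {set I}) (P : I -> {set {set I}}).
Implicit Types (C : {set I}) (i : I).

Local Notation T := (recruit S P).

Lemma subset_recruit C : C \subset T C.
Proof. exact: subsetUl. Qed.

Lemma iter_recruit_coalition n : coalition C0 S (iter n T C0).
Proof.
elim: n => [|n /andP[C0sub subU]]; first by rewrite /coalition subxx subsetUl.
rewrite /coalition (subset_trans C0sub (subset_recruit _)) /= subUset subU.
by apply/subsetP=> i; rewrite !inE => /andP[/andP[_ ->] _]; rewrite orbT.
Qed.

Lemma recruit_full C : S \subset C -> T C = C.
Proof.
rewrite -setD_eq0 /recruit => /eqP->.
by apply/setP=> i; rewrite !inE orbF.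
Qed.

Lemma card_recruitI C : T C != C -> #|C :&: S| < #|T C :&: S|.
Proof.
move=> neqTC; apply: proper_card; rewrite properE setSI ?subset_recruit //=.
apply: contra neqTC => subTC; rewrite eqEsubset subset_recruit andbT.
apply/subsetP=> i TCi; have [//|C'i] := boolP (i \in C).
have Si : i \in S by move: TCi; rewrite !inE (negPf C'i) => /andP[].
have : i \in C :&: S by rewrite (subsetP subTC) // inE TCi.
by rewrite inE (negPf C'i).
Qed.

(** Every iteration that is not yet stationary gains a member of [S], so [#|S|] iterations
    suffice. *)
Lemma recruit_Cminus : T (Cminus C0 S P) = Cminus C0 S P.
Proof.
have step n : T (iter n T C0) = iter n T C0 \/ n <= #|iter n T C0 :&: S|.
  elim: n => [|n [fixn | le_n]]; [by right | by left; rewrite iterS !fixn |].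
  have [fixn | neqn] := eqVneq (T (iter n T C0)) (iter n T C0).
    by left; rewrite iterS !fixn.
  by right; apply: leq_ltn_trans le_n (card_recruitI neqn).
(* At [n = #|S|] the second alternative puts all of [S] inside, and nobody is left to recruit. *)
case: (step #|S|) => // le_S; apply: recruit_full.
by apply/setIidPr/eqP; rewrite eqEcard subsetIr.
Qed.

(** Monotone protection lifts the approval of [i] from [i |: C] to [i |: Cminus], and a fixed point
    of [recruit] has already absorbed such an [i]. *)
Lemma Cminus_closed i C : monotone_protection C0 S P ->
  i \in C0 :|: S -> C \subset Cminus C0 S P -> i |: C \in P i ->
  i \in Cminus C0 S P.
Proof.
set K := Cminus C0 S P => monP C0Si subCK PiC.
have /andP[C0K KU] : coalition C0 S K := iter_recruit_coalition #|S|.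
have [/(subsetP C0K) // | C0'i] := boolP (i \in C0).
have [// | K'i] := boolP (i \in K).
have PiK : i |: K \in P i.
  apply: monP PiC _ _; rewrite ?setUS // /coalition subUset sub1set C0Si KU.
  by rewrite (subset_trans C0K (subsetUr _ _)).
(* The goal has become [false]; it is turned back into [i \in K], then into membership in
   [recruit S P K]. *)
rewrite -(negPf K'i); have <- : recruit S P K = K by apply: recruit_Cminus.
by move: C0Si; rewrite !inE (negPf C0'i) (negPf K'i) PiK andbT.
Qed.

End Recruitment.

(** * Public states along a realization *)

Section Histories.
Variables (I : finType) (V : eqType) (C0 S : {set I}).
Variables (P : I -> {set {set I}}) (M : mechanism I V).
Implicit Types (a x : action M) (h : seq (action M)) (i j : I).

Local Notation pub := (@public_state I V C0 M).

Lemma public_state_rcons h a : pub (rcons h a) = pub h :|: names a.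
Proof. by rewrite /public_state -cats1 big_cat big_seq1 setUA. Qed.

Lemma mem_public_state h x i : x \in h -> i \in names x -> i \in pub h.
Proof.
move=> hx xi; rewrite /public_state inE; apply/orP; right.
by rewrite (big_rem x) //= inE xi.
Qed.

Lemma public_state_mono h h' : {subset h <= h'} -> pub h \subset pub h'.
Proof.
move=> subh; rewrite subUset subsetUl /=; apply/subsetP=> i.
elim: h subh => [|x h IH] subh; first by rewrite big_nil inE.
rewrite big_cons inE => /orP[xi | /IH->] //.
  by apply: mem_public_state xi; rewrite subh ?mem_head.
by move=> y hy; rewrite subh // inE hy orbT.
Qed.

Lemma first_leave (K : {set I}) h : C0 \subset K -> ~~ (pub h \subset K) ->
  exists h1 a, [/\ prefix (rcons h1 a) h, pub h1 \subset K
                 & ~~ (pub (rcons h1 a) \subset K)].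
Proof.
move=> C0K; elim/last_ind: h => [|h a IH].
  by rewrite /public_state big_nil setU0 C0K.
have [hK aK | h'K _] := boolP (pub h \subset K).
  by exists h, a; rewrite prefix_refl.
have [h1 [b [h1b h1K bK]]] := IH h'K.
by exists h1, b; split=> //; apply: prefix_trans h1b (prefix_rcons _ _).
Qed.

Lemma names_public a i : attribution_rules C0 S M -> i \in names a -> public a.
Proof.
move=> attrM; have [_ _ private0] := attrM a.
by apply: contraLR => /private0->; rewrite inE.
Qed.

Lemma public_stateE h a :
  pub (rcons h a) = newly_named C0 h a :|: pub h.
Proof.
apply/setP=> i; rewrite public_state_rcons in_setU in_setU in_setD.
by case: (i \in pub h); case: (i \in names a).
Qed.

Lemma leave_names_other r h a :
    attribution_rules C0 S M -> monotone_protection C0 S P ->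
    regret_free C0 P M -> admissible M r -> completes r h a ->
    pub h \subset Cminus C0 S P -> ~~ (pub (rcons h a) \subset Cminus C0 S P) ->
  exists2 j, j \in newly_named C0 h a & author a <> inl j.
Proof.
move=> attrM monP rfM admr compl hK aK.
case: (pickP [pred j in newly_named C0 h a | author a != inl j]) => [j | none].
  by case/andP=> newj /eqP; exists j.
have newE i : i \in newly_named C0 h a -> author a = inl i.
  by move=> newi; have := none i; rewrite /= newi /= => /negbFE/eqP.
case/subsetPn: aK => i ai Ki; have h'i := contra (subsetP hK i) Ki.
have newi : i \in newly_named C0 h a.
  by move: ai; rewrite public_stateE inE (negPf h'i) orbF.
have stateE : pub (rcons h a) = i |: pub h.
  rewrite public_stateE; congr (_ :|: _); apply/eqP.
  rewrite eqEsubset sub1set newi andbT; apply/subsetP=> k /newE.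
  by rewrite inE (newE i newi) => -[->].
have C0Si : i \in C0 :|: S.
  by have [sub_a _ _] := attrM a; move: newi => /setDP[/(subsetP sub_a)].
have := rfM _ _ _ admr compl i ai.
by rewrite stateE => /(Cminus_closed monP C0Si hK) Ki'; rewrite Ki' in Ki.
Qed.

(** * Device actions: execution, completion and permissions *)

Lemma exposure_names a i : exposure a -> i \in names a -> author a = inl i.
Proof.
by case/andP=> _ /existsP[j /andP[/eqP-> /eqP->]]; rewrite inE => /eqP->.
Qed.

Lemma publication_not_individual a : publication a -> ~~ individual a.
Proof.
case/andP=> puba /negPf expa.
by rewrite /individual /commitment expa puba andbF.
Qed.

(** Completed attempts are individual, so any other action completes among the device actions, where
    execution and completion coincide. *)
Lemma completes_executes r h a :
  well_formed r -> completes r h a -> ~~ individual a ->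
  exists t, executes r t a h.
Proof.
case=> _ _ wf; rewrite /completes /completions /past take_size => compl nind.
have [t [u [v [Et Eh]]]] := prefix_rcons_flatten compl; exists t; right.
have lt_t : t < size r.
  rewrite ltnNge; apply/negP=> le_rt; move: Et; rewrite nth_default ?size_map //.
  by case: (u).
move: Et; rewrite (nth_map (Stage [::] [::] [::])) //; move: (wf t) => /=.
set s := nth _ r t => -[/allP attI folA _] Es.
have a_fol : a \notin followed s by apply: contra nind => /folA/attI.
(* A shorter [u] would place [a] among [followed s]. *)
have le_u : size (followed s) <= size u.
  rewrite leqNgt; apply: contra a_fol => lt_u.
  have -> : a = nth a (followed s ++ device_acts s) (size u).
    by rewrite Es nth_cat ltnn subnn.
  by rewrite nth_cat lt_u mem_nth.
have Eu : u = followed s ++ drop (size (followed s)) u.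
  have := congr1 (take (size (followed s))) Es.
  rewrite take_size_cat // takel_cat // => {1}->.
  by rewrite cat_take_drop.
exists (drop (size (followed s)) u), v; rewrite -Eu; split.
  by move: Es; rewrite {1}Eu -catA => /eqP; rewrite eqseq_cat // eqxx => /eqP.
by rewrite Eh /past map_take.
Qed.

Lemma executes_completes r t h a :
  well_formed r -> executes r t a h -> ~~ individual a -> completes r h a.
Proof.
case=> _ _ wf; move: (wf t) => /=; rewrite /executes /=.
set s := nth _ r t => -[/allP attI _ _].
case=> [[/attI->] // | [u [v [Es ->]]] _].
have lt_t : t < size r.
  rewrite ltnNge; apply/negP=> le_rt; move: Es.
  by rewrite /s nth_default //; case: (u).
rewrite /completes /completions /past take_size.
rewrite -{2}(cat_take_drop t r) (drop_nth (Stage [::] [::] [::])) // -/s.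
rewrite map_cat flatten_cat /= Es.
apply/prefixP; eexists (v ++ _); by rewrite cat_rcons -!catA.
Qed.

(* Twin histories exclude the permissions of [j] that the device does not see,
   one at a time. *)
Lemma permission_viewed sel view r t a h j :
    causal_environment C0 S M -> relies_only_on C0 sel view ->
    admissible M r -> executes r t a h -> sel a -> ~~ individual a ->
    j \in names a -> author a <> inl j -> j \in S -> j \notin pub h ->
  exists x, [/\ x \in h, commitment x, permits x, author x = inl j
              & view (executor a) x].
Proof.
case=> attrM wfM _ _ permM [_ twin] admr ex_a sel_a nind ja authNj Sj.
(* Strong induction on the length of [h]; the realization and the date are generalized because a
   twin may change them. *)
elim: {h}(size h).+1 {-2}h (ltnSn (size h)) r t admr ex_a => // n IH h.
rewrite ltnS => le_hn r t admr ex_a h'j.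
have compl_a := executes_completes (wfM r admr) ex_a nind.
have [x [hx authx permx]] := permM r h a j admr compl_a ja Sj authNj.
(* A public [x] would name its author [j], who is not in the public state of [h]. *)
have commx : commitment x.
  rewrite /commitment; apply/andP; split; last by apply/existsP; exists j; apply/eqP.
  apply: contra h'j => pubx; apply: mem_public_state hx _.
  by have [_ named _] := attrM x; apply: named.
have [viewx | viewNx] := boolP (view (executor a) x); first by exists x.
have unx : unattributed C0 h x by exists j.
have [r' [t' [h' [admr' ex_a' _ subh h'x]]]] :=
  twin r t a h x admr ex_a sel_a hx unx viewNx.
(* Without repetitions, [h'] is strictly shorter than [h], since it lies in [h] and misses [x]. *)
have uniq_h' : uniq h'.
  have [_ uniq_r' _] := wfM r' admr'.
  have := executes_completes (wfM r' admr') ex_a' nind.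
  case/prefixP=> w Ew; move: uniq_r'; rewrite Ew cat_uniq rcons_uniq.
  by case/andP=> /andP[].
have lt_h' : size h' < n.
  apply: leq_trans le_hn.
  rewrite -[(size h').+1]/(size (x :: h')); apply: uniq_leq_size.
    by rewrite /= h'x uniq_h'.
  by move=> y; rewrite inE => /orP[/eqP-> // | /subh].
have h'j' : j \notin pub h' by apply: contra h'j => /(subsetP (public_state_mono subh)).
have [y [h'y commy permy authy viewy]] := IH h' lt_h' r' t' admr' ex_a' h'j'.
by exists y; split=> //; apply: subh.
Qed.

(** The common start of both parts: exposures name only their authors, so naming [j] makes the
    crossing action a publication. *)
Lemma first_publication r D :
    causal_environment C0 S M -> monotone_protection C0 S P ->
    regret_free C0 P M -> admissible M r -> reaches_in C0 M r D ->
    ~~ (D \subset Cminus C0 S P) ->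
  exists h a t j,
    [/\ [/\ completes r h a, pub h \subset Cminus C0 S P
          & ~~ (pub (rcons h a) \subset Cminus C0 S P)],
        executes r t a h, publication a, j \in newly_named C0 h a
      & author a <> inl j].
Proof.
move=> [attrM wfM _ _ _] monP rfM admr [h0 pre_h0 ->] leave0.
have /andP[C0K _] : coalition C0 S (Cminus C0 S P).
  exact: iter_recruit_coalition.
have [h [a [pre_h hK aK]]] := first_leave C0K leave0.
have compl : completes r h a := prefix_trans pre_h pre_h0.
have [j newj authNj] := leave_names_other attrM monP rfM admr compl hK aK.
have /setDP[ja _] := newj.
have publ : publication a.
  rewrite /publication (names_public attrM ja) /=.
  by apply/negP=> /exposure_names /(_ ja).
have [t ex_a] :=
  completes_executes (wfM r admr) compl (publication_not_individual publ).
by exists h, a, t, j.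
Qed.

(** The public state always contains [C0], so a person not yet in it can only come from [S]. *)
Lemma newly_named_recruit h a j : attribution_rules C0 S M ->
  j \in newly_named C0 h a -> [/\ j \in names a, j \notin pub h & j \in S].
Proof.
move=> attrM /setDP[ja h'j]; split=> //.
have [sub_a _ _] := attrM a; move: (subsetP sub_a j ja) h'j.
by rewrite !inE => /orP[-> | ].
Qed.

End Histories.

Theorem theorem4 (I : finType) (V : eqType) (C0 N S : {set I})
    (P : I -> {set {set I}}) (M : mechanism I V)
    (disjC0N : [disjoint C0 & N]) (subSN : S \subset N)
    (protP : protection_family C0 S P)
    (monP : monotone_protection C0 S P)
    (ltC : Cminus C0 S P \proper Cplus C0 S P)
    (mechM : expression_mechanism C0 S M)
    (ftuM : follow_through_uncertainty M)
    (rfM : regret_free C0 P M) :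
  (public_only C0 M ->
     (forall r D, admissible M r -> reaches_in C0 M r D ->
        C0 \subset D /\ D \subset Cminus C0 S P) /\
     ~ implements C0 M (Cplus C0 S P)) /\
  (forall r D, admissible M r -> reaches_in C0 M r D ->
     ~~ (D \subset Cminus C0 S P) ->
     conditional_release C0 M r (Cminus C0 S P)).
Proof.
case: mechM => causM _; have [attrM _ _ recM _] := causM; split=> [pubM | ].
  have inside r D : admissible M r -> reaches_in C0 M r D ->
      C0 \subset D /\ D \subset Cminus C0 S P.
    move=> admr reachD; split; first by case: reachD => h _ ->; apply: subsetUl.
    apply/negPn/negP=> leaveD.
    have [h [a [t [j [_ ex_a publ newj authNj]]]]] :=
      first_publication causM monP rfM admr reachD leaveD.
    have [ja h'j Sj] := newly_named_recruit attrM newj.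
    (* A view restricted to exposures would force the private commitment [x] to be public. *)
    have [x [_ /andP[/negPf privx _] _ _]] := permission_viewed causM pubM admr
      ex_a publ (publication_not_individual publ) ja authNj Sj h'j.
    by rewrite /exposure privx.
  split=> // -[r admr /(inside r _ admr)[_]].
  by apply/negP; case/andP: ltC.
move=> r D admr reachD leaveD.
have [h [a [t [j [[compl hK aK] ex_a publ newj authNj]]]]] :=
  first_publication causM monP rfM admr reachD leaveD.
have received k : k \in newly_named C0 h a -> author a <> inl k ->
    exists2 x, received_commitment (executor a) h k x & unattributed C0 h x.
  move=> newk authNk; have [ka h'k Sk] := newly_named_recruit attrM newk.
  (* Here the view is the full record; a private permission enters it only by receipt. *)
  have [x [hx commx permx authx]] := permission_viewed causM recM admr
    ex_a isT (publication_not_individual publ) ka authNk Sk h'k.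
  case/andP: (commx) => /negPf-> _ /= recx.
  by exists x => //; exists k.
(* A device action completes when executed, so [h] serves as both histories; [j] then makes the set
   of commitments nonempty. *)
exists h, a, t, h; split=> //; split=> //.
by have [x recx unx] := received j newj authNj; exists j, x.
Qed.
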